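(* Let $R$ be a ring with unity. Let $\mathcal{U}$ and $\mathcal{V}$ be subcategories of the category $\operatorname{Mod}R$ of left $R$-modules such that $\mathcal{U}$ is closed under finite direct sums and contains $R$, and $\mathcal{V}$ is closed under isomorphisms and direct summands. Assume further that each module in $\mathcal{U}$ injects into a module in $\mathcal{V}$ (i.e., admits an injective $R$-homomorphism to some module in $\mathcal{V}$). The following are equivalent: (i) The containment $\mathcal{U}\subseteq\mathcal{V}$ holds. (ii) Every module in $\mathcal{U}$ is a trace submodule of a module in $\mathcal{V}$. (iii) Every module in $\mathcal{U}$ is trace in a module in $\mathcal{V}$ up to isomorphism. If in addition $\mathcal{V}$ is preenveloping for $\mathcal{U}$, these are also equivalent to: (iv) Every module in $\mathcal{U}$ is trace in some $\mathcal{V}$-preenvelope (of it) up to isomorphism. If in addition $\mathcal{V}$ is enveloping for $\mathcal{U}$, these are also equivalent to: (v) Every module in $\mathcal{U}$ is trace in its $\mathcal{V}$-envelope up to isomorphism.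
   Context: $R$ is a ring with unity, not necessarily commutative; modules are left modules. For $R$-modules $M,X$, the trace module of $M$ in $X$ is $\tau_M(X)=\sum_{\alpha\in\operatorname{Hom}_R(M,X)}\alpha(M)\subseteq X$. A submodule $M\subseteq X$ is a trace submodule of $X$ if $M=\tau_N(X)$ for some $R$-module $N$. For an injective $R$-homomorphism $\iota:M\to X$, $M$ is trace in $X$ via $\iota$ if $\operatorname{Im}(\iota)$ is a trace submodule of $X$. $M$ is trace in $X$ up to isomorphism if there exists an injection $\iota:M\to X$ such that $\operatorname{Im}(\iota)$ is a trace submodule of $X$. For a class $\mathcal{V}$ of $R$-modules, a $\mathcal{V}$-preenvelope of $M$ is an $R$-homomorphism $\varphi:M\to V$ with $V\in\mathcal{V}$ such that for any $\psi:M\to V'$ with $V'\in\mathcal{V}$ there exists $\alpha:V\to V'$ with $\alpha\varphi=\psi$. A $\mathcal{V}$-envelope of $M$ is a $\mathcal{V}$-preenvelope $\varphi:M\to V$ such that every $\alpha:V\to V$ with $\alpha\varphi=\varphi$ is an isomorphism. $\mathcal{V}$ is (pre)enveloping for $\mathcal{U}$ if every module in $\mathcal{U}$ has a $\mathcal{V}$-(pre)envelope. *)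

(* Defs.v *)
From HB Require Import structures.
From mathcomp Require Import all_boot all_algebra.

Set Implicit Arguments.
Unset Strict Implicit.
Unset Printing Implicit Defensive.

Import GRing.Theory.
Local Open Scope ring_scope.

(* [pzRingType] is the structure of all rings with unity, neither commutative
   nor nontrivial in general, and [lmodType R] that of all left R-modules.
   A (full) subcategory of Mod R is given by its class of objects, a predicate
   on [lmodType R]. *)

(* [trace M X x]: x lies in the sum of submodules \sum_alpha alpha(M), i.e. is
   a finite sum of elements of images of R-homomorphisms M -> X. *)
Definition trace (R : pzRingType) (M X : lmodType R) (x : X) : Prop :=
  exists (n : nat) (alpha : 'I_n -> {linear M -> X}) (m : 'I_n -> M),
    x = \sum_(i < n) alpha i (m i).

Definition is_trace (R : pzRingType) (X : lmodType R) (S : X -> Prop) : Prop :=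
  exists N : lmodType R, forall x : X, S x <-> trace N x.

Definition trace_via (R : pzRingType) (M X : lmodType R)
    (iota : {linear M -> X}) : Prop :=
  is_trace (fun x : X => exists m : M, iota m = x).

(* M is itself (and not only up to isomorphism) a submodule of X: it is the
   module underlying a submodule structure, carved out by S, of X. *)
Definition trace_submodule (R : pzRingType) (M X : lmodType R) : Prop :=
  exists (S : pred X) (W : subLmodType S),
    (W : lmodType R) = M /\ is_trace (fun x : X => S x).

Definition trace_up_to_iso (R : pzRingType) (M X : lmodType R) : Prop :=
  exists iota : {linear M -> X}, injective iota /\ trace_via iota.

Definition isomorphic (R : pzRingType) (M N : lmodType R) : Prop :=
  exists f : {linear M -> N}, bijective f.

(* D is a direct sum of the finite family M: the homomorphism from the external
   direct sum to D induced by the maps [inj i] is surjective and injective. *)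
Definition is_direct_sum (R : pzRingType) (I : finType) (M : I -> lmodType R)
    (D : lmodType R) : Prop :=
  exists inj : forall i : I, {linear M i -> D},
    (forall x : D, exists m : forall i : I, M i, x = \sum_i inj i (m i)) /\
    (forall m : forall i : I, M i,
       \sum_i inj i (m i) = 0 -> forall i : I, m i = 0).

Definition direct_summand (R : pzRingType) (M X : lmodType R) : Prop :=
  exists N : lmodType R, isomorphic (M * N)%type X.

(* Direct sums being defined up to isomorphism, and U not being assumed closed
   under isomorphisms, U is only required to contain some direct sum of each
   nonempty finite family of its members. *)
Definition closed_under_finite_direct_sums (R : pzRingType)
    (U : lmodType R -> Prop) : Prop :=
  forall (I : finType) (M : I -> lmodType R), (0 < #|I|)%N ->
    (forall i : I, U (M i)) ->
    exists D : lmodType R, U D /\ is_direct_sum M D.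

Definition closed_under_isomorphisms (R : pzRingType)
    (V : lmodType R -> Prop) : Prop :=
  forall M N : lmodType R, V M -> isomorphic M N -> V N.

Definition closed_under_direct_summands (R : pzRingType)
    (V : lmodType R -> Prop) : Prop :=
  forall M X : lmodType R, V X -> direct_summand M X -> V M.

Definition preenvelope (R : pzRingType) (V : lmodType R -> Prop)
    (M X : lmodType R) (phi : {linear M -> X}) : Prop :=
  V X /\
  forall (X' : lmodType R) (psi : {linear M -> X'}), V X' ->
    exists alpha : {linear X -> X'}, forall m : M, alpha (phi m) = psi m.

Definition envelope (R : pzRingType) (V : lmodType R -> Prop)
    (M X : lmodType R) (phi : {linear M -> X}) : Prop :=
  preenvelope V phi /\
  forall alpha : {linear X -> X},
    (forall m : M, alpha (phi m) = phi m) -> bijective alpha.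

Definition preenveloping_for (R : pzRingType) (V U : lmodType R -> Prop) :
    Prop :=
  forall M : lmodType R, U M ->
    exists (X : lmodType R) (phi : {linear M -> X}), preenvelope V phi.

Definition enveloping_for (R : pzRingType) (V U : lmodType R -> Prop) : Prop :=
  forall M : lmodType R, U M ->
    exists (X : lmodType R) (phi : {linear M -> X}), envelope V phi.

(* Main.v *)
From HB Require Import structures.
Require Import Defs.
From mathcomp Require Import all_boot all_algebra.
Local Open Scope ring_scope.

Set Implicit Arguments.
Unset Strict Implicit.
Unset Printing Implicit Defensive.

Import GRing.Theory.

(** If [M] is in [U] then so is [D = M (+) R], which by (iii) embeds in some
    [X] in [V] with image a trace submodule. A trace submodule of [X] contains
    the image of every homomorphism from itself to [X]; as [R] is a summand of
    [D], every element of [X] lies in such an image. Hence [D] is isomorphic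
    to [X], and its direct summand [M] belongs to [V]. *)

Section TraceModules.
Variable R : pzRingType.
Implicit Types M N X D : lmodType R.

(* Stated with a [sig] type so that lifts of a whole family can be chosen. *)
Lemma linear_lift M N X (iota : {linear M -> X}) (beta : {linear N -> X}) :
    injective iota -> (forall n, exists m, iota m = beta n) ->
  {gamma : {linear N -> M} | forall n, iota (gamma n) = beta n}.
Proof.
move=> iota_inj beta_im.
(* Phrased with boolean equality so that [xchoose] can pick preimages; injectivity of [iota] then
   forces the picked function to be linear. *)
have beta_im_eq n : exists m, iota m == beta n.
  by have [m <-] := beta_im n; exists m.
pose g n := xchoose (beta_im_eq n).
have gK n : iota (g n) = beta n by apply/eqP; exact: (xchooseP (beta_im_eq n)).
have g_lin : linear g.
  by move=> a u v; apply: iota_inj; rewrite linearP !gK linearP.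
pose gL := GRing.isLinear.Build R N M *:%R g g_lin.
pose gamma : {linear N -> M} := HB.pack g gL.
by exists gamma.
Qed.

Lemma isomorphic_of_bij M X (f : {linear M -> X}) :
  injective f -> (forall x, exists m, f m = x) -> isomorphic X M.
Proof.
move=> f_inj f_surj; have [g gK] := linear_lift (beta := idfun) f_inj f_surj.
by exists g; exists f => // m; apply: f_inj; rewrite gK.
Qed.

Lemma trace_linear M X (f : {linear M -> X}) m : trace M (f m).
Proof. by exists 1%N, (fun=> f), (fun=> m); rewrite big_ord1. Qed.

Lemma trace_up_to_iso_of_bij M X (f : {linear M -> X}) :
  injective f -> (forall x, exists m, f m = x) -> trace_up_to_iso M X.
Proof.
move=> f_inj f_surj; exists f; split=> //; exists M => x.
by split=> // _; have [m <-] := f_surj x; apply: trace_linear.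
Qed.

(** Write [iota m] as a sum of terms [beta i (y i)] with [beta i : N -> X]. Each [beta i] lands in
    the image of [iota], so it factors as [iota \o gamma i]. Cancelling [iota] gives [m] as the sum
    of the [gamma i (y i)], and the maps [alpha \o gamma i] exhibit [alpha m] in the trace of
    [N]. *)
Lemma trace_via_absorbs M X (iota alpha : {linear M -> X}) (m : M) :
  injective iota -> trace_via iota -> exists m', iota m' = alpha m.
Proof.
move=> iota_inj [N iota_trace]; apply/iota_trace.
have [|n [beta [y iota_m]]] := (iota_trace (iota m)).1; first by exists m.
have beta_im i z : exists m', iota m' = beta i z.
  by apply/iota_trace; exact: trace_linear.
pose gamma i := sval (linear_lift iota_inj (beta_im i)).
have gammaK i z : iota (gamma i z) = beta i z.
  by rewrite /gamma; case: linear_lift.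
have -> : m = \sum_(i < n) gamma i (y i).
  by apply: (iota_inj); rewrite linear_sum iota_m; apply: eq_bigr.
by exists n, (fun i => alpha \o gamma i), y; rewrite linear_sum.
Qed.

(** The map [a |-> a *: x] composed with [p] sends [d] to [x], so absorption puts [x] in the image
    of [iota]. *)
Lemma trace_via_surj D X (iota : {linear D -> X}) (p : {linear D -> R^o}) d :
  injective iota -> trace_via iota -> p d = 1 ->
  forall x, exists m, iota m = x.
Proof.
move=> iota_inj iota_trace pd1 x.
have scale_lin : linear (fun a : R^o => (a : R) *: x).
  by move=> a u v; rewrite scalerDl scalerA.
pose scale : {linear R^o -> X} :=
  HB.pack (fun a : R^o => (a : R) *: x) (GRing.isLinear.Build _ _ _ _ _ scale_lin).
have [m Em] := trace_via_absorbs (scale \o p) d iota_inj iota_trace.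
by exists m; rewrite Em /= pd1 scale1r.
Qed.

(* [M] as a submodule of itself, keeping the structure of [M], since
   [trace_submodule] asks for an equality of modules. *)
Definition full_submodule M : subLmodType (@predT M) :=
  let sub := isSub.Build M predT M (val_subdef := idfun) (Sub := fun x _ => x)
    (fun K K_Sub u => K_Sub u isT) (fun _ _ => erefl) in
  let W0 : subChoiceType (@predT M) := HB.pack (GRing.Lmodule.sort M) sub in
  let add := Algebra.isSubBaseAddUMagma.Build M predT W0
    (erefl, fun _ _ => erefl) in
  let W1 : subZmodType (@predT M) := HB.pack (GRing.Lmodule.sort M) sub add in
  let scale := GRing.isSubLSemiModule.Build R M predT W1 (fun _ _ => erefl) in
  HB.pack (GRing.Lmodule.sort M) sub add scale.

(** Both sides become convertible once the structure on [M] is split into its components. *)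
Lemma full_submoduleE M : full_submodule M = M :> lmodType R.
Proof. by case: M => T []. Qed.

Lemma trace_submodule_refl M : trace_submodule M M.
Proof.
exists predT; exists (full_submodule M); split; first exact: full_submoduleE.
by exists M => x; split=> // _; exact: (trace_linear idfun).
Qed.

Lemma trace_submodule_up_to_iso M X :
  trace_submodule M X -> trace_up_to_iso M X.
Proof.
move=> [S [W [<- S_trace]]]; exists (val : {linear W -> X}).
split; first exact: val_inj.
have [N SN] := S_trace; exists N => x; apply: iff_trans (SN x).
split=> [[m <-]|Sx]; first exact: valP.
by exists (Sub x Sx); exact: SubK.
Qed.

Lemma direct_sum_pair (F : bool -> lmodType R) D :
    is_direct_sum F D ->
  exists f : {linear (F true * F false)%type -> D},
    injective f /\ forall x, exists u, f u = x.
Proof.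
move=> [inj [inj_surj inj_indep]].
pose f0 (u : F true * F false) := inj true u.1 + inj false u.2.
have f_lin : linear f0.
  by move=> a u v; rewrite /f0 /= !linearP scalerDr addrACA.
pose f : {linear (F true * F false)%type -> D} :=
  HB.pack f0 (GRing.isLinear.Build _ _ _ _ f0 f_lin).
have sum_bool (m : forall b, F b) : \sum_b inj b (m b) = f (m true, m false).
  by rewrite big_bool.
exists f; split.
- apply: raddf_inj => -[u v] fuv0.
  pose m b : F b := if b is true then u else v.
  have m0 := inj_indep m (etrans (sum_bool m) fuv0).
  by have /= -> := m0 true; have /= -> := m0 false.
- by move=> x; have [m ->] := inj_surj x; rewrite sum_bool; eexists.
Qed.

Lemma summand_of_trace M (V U : lmodType R -> Prop) :
    closed_under_finite_direct_sums U -> U R^o ->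
    closed_under_isomorphisms V -> closed_under_direct_summands V ->
    (forall D, U D -> exists X, V X /\ trace_up_to_iso D X) ->
  U M -> V M.
Proof.
move=> U_sums U_ring V_iso V_summands U_trace UM.
pose F b : lmodType R := if b is true then M else R^o.
have [|[] //|D [UD /direct_sum_pair[f [f_inj f_surj]]]] := U_sums _ F.
  by rewrite card_bool.
have [X [VX [iota [iota_inj iota_trace]]]] := U_trace D UD.
have [g gK] := linear_lift (beta := idfun) f_inj f_surj.
have iota_surj : forall x, exists d, iota d = x.
  (* Since [g] inverts [f], [snd \o g] is the projection of [D] onto its summand [R^o], and it takes
     the value 1 at [f (0, 1)]. *)
  apply: (@trace_via_surj D X iota (snd \o g) (f (0, 1))) => //=.
  by rewrite (f_inj _ _ (gK _)).
apply: (V_summands M D).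
  exact: V_iso VX (isomorphic_of_bij iota_inj iota_surj).
by exists R^o, f; exists g => // u; apply: f_inj; rewrite gK.
Qed.

Lemma preenvelope_id M (V : lmodType R -> Prop) :
  V M -> preenvelope V (idfun : {linear M -> M}).
Proof. by move=> VM; split=> // X' psi _; exists psi. Qed.

(** Extending the identity of [M] along [phi] gives a retraction [alpha], hence injectivity. The
    endomorphism [phi \o alpha] fixes [phi], so it is bijective, and [phi] is onto. *)
Lemma envelope_bij M X (V : lmodType R -> Prop) (phi : {linear M -> X}) :
    V M -> envelope V phi ->
  injective phi /\ forall x, exists m, phi m = x.
Proof.
move=> VM [[_ ext] end_bij].
have [alpha alphaK] := ext M idfun VM.
have [|b _ bK] := end_bij (phi \o alpha); first by move=> m /=; rewrite alphaK.
split; first exact: can_inj alphaK.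
by move=> x; exists (alpha (b x)); exact: bK.
Qed.

End TraceModules.

Theorem theorem4p1 (R : pzRingType) (U V : lmodType R -> Prop)
    (U_sums : closed_under_finite_direct_sums U)
    (U_ring : U R^o)
    (V_iso : closed_under_isomorphisms V)
    (V_summands : closed_under_direct_summands V)
    (U_injects : forall M : lmodType R, U M ->
       exists X : lmodType R, V X /\
         exists f : {linear M -> X}, injective f) :
  [/\ [<-> (* (i) *)   (forall M : lmodType R, U M -> V M);
           (* (ii) *)  (forall M : lmodType R, U M ->
                          exists X : lmodType R, V X /\ trace_submodule M X);
           (* (iii) *) (forall M : lmodType R, U M ->
                          exists X : lmodType R, V X /\ trace_up_to_iso M X)],
      preenveloping_for V U ->
        ((forall M : lmodType R, U M -> V M) <->
         (* (iv) *)
         (forall M : lmodType R, U M ->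
            exists (X : lmodType R) (phi : {linear M -> X}),
              preenvelope V phi /\ trace_up_to_iso M X))
    & enveloping_for V U ->
        ((forall M : lmodType R, U M -> V M) <->
         (* (v) *)
         (forall M : lmodType R, U M ->
            forall (X : lmodType R) (phi : {linear M -> X}),
              envelope V phi -> trace_up_to_iso M X))].
Proof.
(* This is (iii) implies (i); the converse directions from (iv) and (v) pass through (iii) as
   well. *)
have trace_U : (forall M : lmodType R, U M ->
    exists X : lmodType R, V X /\ trace_up_to_iso M X) ->
    forall M : lmodType R, U M -> V M.
  by move=> U_trace M; exact: summand_of_trace.
split.
- tfae=> [UV M UM|U_trace M UM|//].
  + by exists M; split; [exact: UV | exact: trace_submodule_refl].
  + have [X [VX MX]] := U_trace M UM.
    by exists X; split=> //; exact: trace_submodule_up_to_iso.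
- move=> _; split=> [UV M UM|U_trace].
  + exists M, idfun; split; first exact/preenvelope_id/UV.
    by apply: (trace_up_to_iso_of_bij (f := idfun)) => // x; exists x.
  + apply: trace_U => M UM.
    by have [X [phi [[VX _] MX]]] := U_trace M UM; exists X.
- move=> U_env; split=> [UV M UM X phi phi_env|U_trace].
  + have [phi_inj phi_surj] := envelope_bij (UV M UM) phi_env.
    exact: trace_up_to_iso_of_bij phi_inj phi_surj.
  (* Condition (v) speaks of all envelopes, so [U_env] is what provides one to apply it to. *)
  + apply: trace_U => M UM; have [X [phi phi_env]] := U_env M UM.
    exists X; split; first by case: phi_env => -[].
    exact: U_trace phi_env.
Qed.
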